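(* Let $\varphi(x)=c\,e^{-ax^2}$ on $\mathbb{R}$ with $c>0$ and $a>0$. Then the family $\{x^n\varphi(x):n\ge0\}$ is total in $\mathcal{S}(\mathbb{R})$. Consequently, for such a fixed Gaussian kernel, the weak moment sequence uniquely determines the distribution: if $T_1,T_2\in\mathcal{S}'(\mathbb{R})$ satisfy $\langle T_1,x^n\varphi\rangle=\langle T_2,x^n\varphi\rangle$ for all $n\ge0$, then $T_1=T_2$.
   Context: $\mathcal{S}(\mathbb{R})$ is the Schwartz space with its usual Fréchet topology and $\mathcal{S}'(\mathbb{R})$ its dual, the tempered distributions. A family in $\mathcal{S}(\mathbb{R})$ is total if its linear span is dense in $\mathcal{S}(\mathbb{R})$. The $n$-th weak moment of $T$ with respect to $\varphi$ is ${}^{(\varphi)}m_n=\langle T,x^n\varphi\rangle$. *)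

(* Defs.v *)
From HB Require Import structures.
From mathcomp Require Import all_boot all_order all_algebra.
From mathcomp Require Import all_classical all_reals all_analysis.
From mathcomp Require Import complex ring lra.

Set Implicit Arguments.
Unset Strict Implicit.
Unset Printing Implicit Defensive.

Import Order.TTheory GRing.Theory Num.Theory.
Import numFieldNormedType.Exports.
Import Normc.

Local Open Scope ring_scope.
Local Open Scope classical_set_scope.
Local Open Scope complex_scope.

(* [Re] and [Im] would otherwise resolve to the numClosedFieldType versions. *)
Local Notation Re := complex.Re.
Local Notation Im := complex.Im.

Section smooth_real.
Variable R : realType.
Implicit Types f g : R -> R.

Definition smooth f := forall n x, derivable (derive1n n f) x 1.

Lemma smoothD_derive f g n : smooth f -> smooth g ->
  derive1n n (fun x => f x + g x) = (fun x => derive1n n f x + derive1n n g x).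
Proof.
move=> sf sg; elim: n => [//|n IH].
rewrite !derive1nS IH; apply/funext => x.
by rewrite !derive1E deriveD.
Qed.

Lemma smoothD f g : smooth f -> smooth g -> smooth (fun x => f x + g x).
Proof. by move=> sf sg n x; rewrite smoothD_derive//; exact: derivableD. Qed.

Lemma smoothZ_derive (a : R) f n : smooth f ->
  derive1n n (fun x => a * f x) = (fun x => a * derive1n n f x).
Proof.
move=> sf; elim: n => [//|n IH].
rewrite !derive1nS IH; apply/funext => x.
by rewrite !derive1E (@deriveZ _ R^o R^o).
Qed.

Lemma smoothZ (a : R) f : smooth f -> smooth (fun x => a * f x).
Proof.
by move=> sf n x; rewrite smoothZ_derive//; exact: (@derivableZ _ R^o R^o).
Qed.

Lemma smoothX_derive f n : smooth f ->
  derive1n n (fun x => x * f x) =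
    (fun x => x * derive1n n f x + n%:R * derive1n n.-1 f x).
Proof.
move=> sf; elim: n => [|n IH].
  by apply/funext => x; rewrite !derive1n0 mul0r addr0.
rewrite derive1nS IH; apply/funext => x.
have dX : derivable (fun y : R => y * derive1n n f y) x 1.
  exact: (derivableM (@derivable_id _ _ _ _) (sf n x)).
have dn : derivable (fun y : R => n%:R * derive1n n.-1 f y) x 1.
  exact: (@derivableZ _ R^o R^o _ _ _ _ (sf n.-1 x)).
rewrite derive1E (deriveD dX dn) (deriveM (@derivable_id _ _ _ _) (sf n x)).
rewrite derive_id (@deriveZ _ R^o R^o _ _ _ _ (sf n.-1 x)) -!derive1E -!derive1nS.
rewrite /GRing.scale/= mulr1 -addrA; congr (_ + _).
rewrite -natr1 mulrDl mul1r addrC; congr (_ + _).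
by case: n {IH dX dn} => [|n//=]; rewrite !mul0r.
Qed.

Lemma smoothX f : smooth f -> smooth (fun x => x * f x).
Proof.
move=> sf n x; rewrite smoothX_derive//; apply: derivableD.
  exact: (derivableM (@derivable_id _ _ _ _) (sf n x)).
exact: (@derivableZ _ R^o R^o _ _ _ _ (sf n.-1 x)).
Qed.

End smooth_real.

Section schwartz_functions.
Variable R : realType.
Implicit Types f g : R -> R[i].

Definition csmooth f := smooth (@Re R \o f) /\ smooth (@Im R \o f).

(* The library's [derive1n] needs a normedModType over R as codomain, which R[i]
   is not; complex-valued functions are differentiated componentwise. *)
Definition cderiv1n n f : R -> R[i] :=
  fun x => derive1n n (@Re R \o f) x +i* derive1n n (@Im R \o f) x.

Definition is_schwartz f := csmooth f /\
  forall k n, exists M : R, forall x, `|x| ^+ k * normc (cderiv1n n f x) <= M.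

Lemma RefD f g : @Re R \o (f + g) = (fun x => Re (f x) + Re (g x)).
Proof. by apply/funext => x /=; rewrite fctE; case: (f x) (g x) => ? ? []. Qed.

Lemma ImfD f g : @Im R \o (f + g) = (fun x => Im (f x) + Im (g x)).
Proof. by apply/funext => x /=; rewrite fctE; case: (f x) (g x) => ? ? []. Qed.

Lemma RefZ (z : R[i]) f :
  @Re R \o (z *: f) = (fun x => Re z * Re (f x) + - Im z * Im (f x)).
Proof.
by apply/funext => x /=; rewrite fctE/=; case: z (f x) => ? ? [? ?]/=; rewrite mulNr.
Qed.

Lemma ImfZ (z : R[i]) f :
  @Im R \o (z *: f) = (fun x => Re z * Im (f x) + Im z * Re (f x)).
Proof. by apply/funext => x /=; rewrite fctE/=; case: z (f x) => ? ? []. Qed.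

Definition mulX f : R -> R[i] := fun x => x%:C * f x.

Lemma Re_mulX f : @Re R \o mulX f = (fun x => x * Re (f x)).
Proof.
by apply/funext => x /=; rewrite /mulX; case: (f x) => ? ? /=; rewrite mul0r subr0.
Qed.

Lemma Im_mulX f : @Im R \o mulX f = (fun x => x * Im (f x)).
Proof.
by apply/funext => x /=; rewrite /mulX; case: (f x) => ? ? /=; rewrite mul0r addr0.
Qed.

Lemma csmoothD f g : csmooth f -> csmooth g -> csmooth (f + g).
Proof.
move=> [f1 f2] [g1 g2]; split.
  by rewrite RefD; exact (smoothD f1 g1).
by rewrite ImfD; exact (smoothD f2 g2).
Qed.

Lemma csmoothZ z f : csmooth f -> csmooth (z *: f).
Proof.
move=> [f1 f2]; split; rewrite (RefZ, ImfZ).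
  exact (smoothD (smoothZ (a := Re z) f1) (smoothZ (a := - Im z) f2)).
exact (smoothD (smoothZ (a := Re z) f2) (smoothZ (a := Im z) f1)).
Qed.

Lemma csmooth_mulX f : csmooth f -> csmooth (mulX f).
Proof.
by move=> [f1 f2]; split; rewrite (Re_mulX, Im_mulX);
  [exact: (smoothX f1) | exact: (smoothX f2)].
Qed.

Lemma cderiv1nD n f g x : csmooth f -> csmooth g ->
  cderiv1n n (f + g) x = cderiv1n n f x + cderiv1n n g x.
Proof.
move=> [f1 f2] [g1 g2]; rewrite /cderiv1n RefD ImfD.
by rewrite (smoothD_derive n f1 g1) (smoothD_derive n f2 g2).
Qed.

Lemma cderiv1nZ n z f x : csmooth f ->
  cderiv1n n (z *: f) x = z * cderiv1n n f x.
Proof.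
move=> [f1 f2]; rewrite /cderiv1n RefZ ImfZ.
rewrite (smoothD_derive n (smoothZ (a := Re z) f1) (smoothZ (a := - Im z) f2)).
rewrite (smoothD_derive n (smoothZ (a := Re z) f2) (smoothZ (a := Im z) f1)).
rewrite (smoothZ_derive (Re z) n f1) (smoothZ_derive (- Im z) n f2).
rewrite (smoothZ_derive (Re z) n f2) (smoothZ_derive (Im z) n f1).
by case: z => a b /=; rewrite mulNr.
Qed.

Lemma cderiv1n_mulX n f x : csmooth f ->
  cderiv1n n (mulX f) x = x%:C * cderiv1n n f x + n%:R%:C * cderiv1n n.-1 f x.
Proof.
move=> [f1 f2]; rewrite /cderiv1n Re_mulX Im_mulX.
rewrite (smoothX_derive n f1) (smoothX_derive n f2); apply/eqP.
by rewrite eq_complex/= !mul0r !subr0 !addr0 !eqxx.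
Qed.

Lemma normc_real (x : R) : normc x%:C = `|x|.
Proof. by rewrite /normc /= expr0n addr0 sqrtr_sqr. Qed.

Lemma normc_ge0 (z : R[i]) : 0 <= normc z.
Proof. by case: z => a b; exact: sqrtr_ge0. Qed.

Lemma schwartz0 : is_schwartz 0.
Proof.
have E n : derive1n n (fun=> 0 : R) = (fun=> 0 : R).
  elim: n => [//|n IH]; rewrite derive1nS IH; apply/funext => x.
  exact: derive1_cst.
have Re0 : @Re R \o (0 : R -> R[i]) = fun=> 0 by [].
have Im0 : @Im R \o (0 : R -> R[i]) = fun=> 0 by [].
split; first by split=> n x; rewrite (Re0, Im0) E; exact: derivable_cst.
move=> k n; exists 0 => x; rewrite /cderiv1n Re0 Im0 !E.
by rewrite -[0 +i* 0]/(0 : R[i]) normc0 mulr0.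
Qed.

Lemma schwartzD f g : is_schwartz f -> is_schwartz g -> is_schwartz (f + g).
Proof.
move=> [sf bf] [sg bg]; split; first exact: csmoothD.
move=> k n; have [M fM] := bf k n; have [N gN] := bg k n.
exists (M + N) => x; rewrite cderiv1nD//.
apply: (le_trans (ler_wpM2l (exprn_ge0 k (normr_ge0 x)) (le_normcD _ _))).
by rewrite mulrDr; exact: lerD.
Qed.

Lemma schwartzZ z f : is_schwartz f -> is_schwartz (z *: f).
Proof.
move=> [sf bf]; split; first exact: csmoothZ.
move=> k n; have [M fM] := bf k n.
exists (normc z * M) => x; rewrite cderiv1nZ// normcM mulrCA.
exact: ler_wpM2l (normc_ge0 z) _ _ (fM x).
Qed.

Lemma schwartz_mulX f : is_schwartz f -> is_schwartz (mulX f).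
Proof.
move=> [sf bf]; split; first exact: csmooth_mulX.
move=> k n; have [M fM] := bf k.+1 n; have [N gN] := bf k n.-1.
exists (M + n%:R * N) => x; rewrite cderiv1n_mulX//.
apply: (le_trans (ler_wpM2l (exprn_ge0 k (normr_ge0 x)) (le_normcD _ _))).
rewrite mulrDr !normcM !normc_real; apply: lerD.
  by rewrite mulrA -exprSr.
by rewrite mulrCA ger0_norm ?ler0n//; exact: ler_wpM2l.
Qed.

Definition schwartz_pred : {pred R -> R[i]} := fun f => `[< is_schwartz f >].

Lemma schwartz_submod_closed : submod_closed schwartz_pred.
Proof.
split; first exact/asboolP/schwartz0.
move=> z f g /asboolP sf /asboolP sg; apply/asboolP.
exact: schwartzD (schwartzZ z sf) sg.
Qed.

HB.instance Definition _ :=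
  GRing.isSubmodClosed.Build _ _ schwartz_pred schwartz_submod_closed.

Record schwartz := Schwartz {
  schwartz_fun :> R -> R[i];
  schwartzP : schwartz_fun \in schwartz_pred }.

HB.instance Definition _ := [isSub for schwartz_fun].
HB.instance Definition _ := [Choice of schwartz by <:].
HB.instance Definition _ := [SubChoice_isSubLmodule of schwartz by <:].

End schwartz_functions.

Section schwartz_topology.
Variable R : realType.
Implicit Types f g : schwartz R.

Definition schwartz_seminorm k n (f : R -> R[i]) : R :=
  sup (range (fun x => `|x| ^+ k * normc (cderiv1n n f x))).

Lemma schwartz_smooth f : csmooth f.
Proof. by have /asboolP[] := schwartzP f. Qed.

Lemma seminorm_ub k n f x :
  `|x| ^+ k * normc (cderiv1n n f x) <= schwartz_seminorm k n f.
Proof.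
have /asboolP[_ /(_ k n)[M fM]] := schwartzP f.
by apply: ub_le_sup; [exists M => _ [y _ <-] | exists x].
Qed.

Lemma seminorm_le k n (f : R -> R[i]) (M : R) :
  (forall x, `|x| ^+ k * normc (cderiv1n n f x) <= M) -> schwartz_seminorm k n f <= M.
Proof. by move=> fM; apply: ge_sup => [|_ [x _ <-]//]; eexists; exists 0. Qed.

Lemma seminorm_ge0 k n f : 0 <= schwartz_seminorm k n f.
Proof.
apply: le_trans (seminorm_ub k n f 0).
by rewrite mulr_ge0 ?exprn_ge0 ?normc_ge0.
Qed.

Lemma seminormD k n f g : schwartz_seminorm k n (f + g) <=
  schwartz_seminorm k n f + schwartz_seminorm k n g.
Proof.
apply: seminorm_le => x.
rewrite -[schwartz_fun (f + g)]/(schwartz_fun f + schwartz_fun g).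
rewrite (cderiv1nD n x (schwartz_smooth f) (schwartz_smooth g)).
apply: (le_trans (ler_wpM2l (exprn_ge0 k (normr_ge0 x)) (le_normcD _ _))).
by rewrite mulrDr; apply: lerD; exact: seminorm_ub.
Qed.

Lemma seminormZ_le k n (z : R[i]) f :
  schwartz_seminorm k n (z *: f) <= normc z * schwartz_seminorm k n f.
Proof.
apply: seminorm_le => x.
rewrite -[schwartz_fun (z *: f)]/(z *: schwartz_fun f).
rewrite (cderiv1nZ n z x (schwartz_smooth f)) normcM mulrCA.
exact: ler_wpM2l (normc_ge0 z) _ _ (seminorm_ub k n f x).
Qed.

Lemma seminorm0 k n : schwartz_seminorm k n (0 : schwartz R) = 0.
Proof.
apply/eqP; rewrite eq_le seminorm_ge0 andbT.
by have := seminormZ_le k n 0 0; rewrite scale0r normc0 mul0r.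
Qed.

Definition schwartz_ball f N (e : R) : set (schwartz R) :=
  [set g | forall k n, (k <= N)%N -> (n <= N)%N ->
           schwartz_seminorm k n (g - f) < e].

Definition schwartz_nbhs f : set_system (schwartz R) :=
  [set U | exists N (e : R), 0 < e /\ schwartz_ball f N e `<=` U].

Lemma schwartz_ball_center f N e : 0 < e -> schwartz_ball f N e f.
Proof. by move=> e0 k n _ _; rewrite subrr seminorm0. Qed.

Lemma schwartz_ball_trans f g h N e d :
  schwartz_ball f N e g -> schwartz_ball g N d h -> schwartz_ball f N (e + d) h.
Proof.
move=> fg gh k n kN nN.
have -> : h - f = (g - f) + (h - g) by rewrite [RHS]addrC addrA subrK.
by apply: le_lt_trans (seminormD _ _ _ _) _; apply: ltrD; [exact: fg|exact: gh].
Qed.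

Lemma schwartz_ballW f N N' e e' : (N' <= N)%N -> e <= e' ->
  schwartz_ball f N e `<=` schwartz_ball f N' e'.
Proof.
move=> NN ee g fg k n kN nN; apply: lt_le_trans ee.
by apply: fg; apply: leq_trans NN.
Qed.

Lemma schwartz_nbhs_filter f : ProperFilter (schwartz_nbhs f).
Proof.
split; first by move=> [N [e [e0 /(_ f)]]]; apply; exact: schwartz_ball_center.
split; first by exists 0%N, 1.
  move=> U V [N [e [e0 NU]]] [M [d [d0 MV]]].
  exists (maxn N M), (Num.min e d); split; first by rewrite lt_min e0.
  move=> g fg; split.
    by apply/NU/(schwartz_ballW _ _ fg); rewrite ?leq_maxl// ge_min lexx.
  by apply/MV/(schwartz_ballW _ _ fg); rewrite ?leq_maxr// ge_min lexx orbT.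
move=> U V UV [N [e [e0 NU]]]; exists N, e; split=> //.
exact: subset_trans NU UV.
Qed.

Lemma schwartz_nbhs_singleton f (U : set (schwartz R)) : schwartz_nbhs f U -> U f.
Proof. by move=> [N [e [e0]]]; apply; exact: schwartz_ball_center. Qed.

Lemma schwartz_nbhs_nbhs f (U : set (schwartz R)) :
  schwartz_nbhs f U -> schwartz_nbhs f (schwartz_nbhs^~ U).
Proof.
move=> [N [e [e0 NU]]]; exists N, (e / 2); split; first by rewrite divr_gt0.
move=> g fg; exists N, (e / 2); split; first by rewrite divr_gt0.
by move=> h gh; apply: NU; rewrite [e]splitr; exact: schwartz_ball_trans fg gh.
Qed.

(* The locally convex topology generated by the countable family of seminorms
   sup_x |x|^k |f^(n)(x)|. *)
HB.instance Definition _ := hasNbhs.Build (schwartz R) schwartz_nbhs.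
HB.instance Definition _ := Nbhs_isNbhsTopological.Build (schwartz R)
  schwartz_nbhs_filter schwartz_nbhs_singleton schwartz_nbhs_nbhs.

Lemma nbhs_schwartz_ball f N e : 0 < e -> nbhs f (schwartz_ball f N e).
Proof. by move=> e0; exists N, e; split. Qed.

Lemma schwartz_add_continuous :
  continuous (fun x : schwartz R * schwartz R => x.1 + x.2).
Proof.
move=> [f g] U [N [e [e0 NU]]].
have e20 : 0 < e / 2 by rewrite divr_gt0.
exists (schwartz_ball f N (e / 2), schwartz_ball g N (e / 2)).
  by split; exact: nbhs_schwartz_ball.
move=> [f' g'] [/= ff' gg']; apply: NU => k n kN nN /=.
rewrite opprD addrACA [e]splitr.
apply: le_lt_trans (seminormD k n (f' - f) (g' - g)) _.
apply: ltrD.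
  exact: ff' k n kN nN.
exact: gg' k n kN nN.
Qed.

Lemma schwartz_scale_continuous :
  continuous (fun z : R[i]^o * schwartz R => z.1 *: z.2).
Proof.
move=> -[z f] U [N [e [e0 NU]]].
pose M := \sum_(k < N.+1) \sum_(n < N.+1) schwartz_seminorm k n f.
have fM k n : (k <= N)%N -> (n <= N)%N -> schwartz_seminorm k n f <= M.
  move=> kN nN; rewrite /M (bigD1 (inord k))//= (bigD1 (inord n))//=.
  rewrite !inordK// -addrA lerDl addr_ge0//; apply: sumr_ge0 => i _.
    exact: seminorm_ge0.
  by apply: sumr_ge0 => j _; exact: seminorm_ge0.
have M0 : 0 <= M by exact: le_trans (seminorm_ge0 0 0 f) (fM _ _ _ _).
pose d : R := Num.min 1 (e / 2 / (M + 1)).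
have d0 : 0 < d by rewrite lt_min ltr01 !divr_gt0// ltr_wpDl.
pose r := e / 2 / (normc z + 1).
have r0 : 0 < r by rewrite !divr_gt0// ltr_wpDl// normc_ge0.
exists ([set w : R[i]^o | normc ((z : R[i]) - (w : R[i])) < d], schwartz_ball f N r).
  split; last exact: nbhs_schwartz_ball.
  by exists d%:C => /=; [rewrite ltcR | move=> w /=; rewrite ltcR].
move=> [w g] [/= zw fg]; apply: NU => k n kN nN.
change (schwartz_seminorm k n ((w : R[i]) *: g - (z : R[i]) *: f) < e).
have -> : (w : R[i]) *: g - (z : R[i]) *: f =
          (w : R[i]) *: (g - f) + ((w : R[i]) - (z : R[i])) *: f.
  by rewrite scalerBr scalerBl addrA subrK.
rewrite [e]splitr; apply: le_lt_trans (seminormD _ _ _ _) _.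
have wz : normc ((w : R[i]) - (z : R[i])) < d by rewrite -opprB (@normcN R).
apply: ltr_leD.
  apply: le_lt_trans (seminormZ_le _ _ _ _) _.
  have wle : normc w <= normc z + 1.
    rewrite -[w](subrK z) addrC (le_trans (le_normcD _ _))// lerD2l.
    by rewrite ltW// (lt_le_trans wz)// ge_min lexx.
  have -> : e / 2 = (normc z + 1) * r.
    by rewrite /r [RHS]mulrC divfK// gt_eqF// ltr_wpDl// normc_ge0.
  apply: le_lt_trans (ler_wpM2r (seminorm_ge0 _ _ _) wle) _.
  by rewrite ltr_pM2l ?ltr_wpDl ?normc_ge0//; exact: fg.
apply: le_trans (seminormZ_le _ _ _ _) _.
have -> : e / 2 = (e / 2 / (M + 1)) * (M + 1).
  by rewrite divfK// gt_eqF// ltr_wpDl.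
apply: ler_pM; rewrite ?normc_ge0 ?seminorm_ge0//.
  by rewrite (le_trans (ltW wz))// ge_min lexx orbT.
by rewrite (le_trans (fM _ _ kN nN))// lerDl.
Qed.

Lemma schwartz_ball_open f N e : open (schwartz_ball f N e).
Proof.
rewrite openE => g fg.
pose m := \big[Num.max/0]_(k < N.+1) \big[Num.max/0]_(n < N.+1)
  schwartz_seminorm k n (g - f).
have gm k n : (k <= N)%N -> (n <= N)%N -> schwartz_seminorm k n (g - f) <= m.
  move=> kN nN; rewrite /m.
  apply: le_trans (le_bigmax _ _ (inord k : 'I_N.+1)).
  by apply: le_trans (le_bigmax _ _ (inord n : 'I_N.+1)); rewrite !inordK.
have me : m < e.
  have e0 : 0 < e by exact: le_lt_trans (seminorm_ge0 0 0 (g - f)) (fg _ _ _ _).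
  by apply: bigmax_lt => // i _; apply: bigmax_lt => // j _; apply: fg; rewrite -ltnS.
exists N, (e - m); split; first by rewrite subr_gt0.
move=> h gh k n kN nN.
have -> : h - f = (g - f) + (h - g) by rewrite [RHS]addrC addrA subrK.
apply: le_lt_trans (seminormD _ _ _ _) _.
by rewrite -[ltRHS](subrKC m); apply: ler_ltD; [exact: gm|exact: gh].
Qed.

Lemma schwartz_ball_conv f N e g h (l : R[i]) : 0 <= l -> l <= 1 ->
  schwartz_ball f N e g -> schwartz_ball f N e h ->
  schwartz_ball f N e (l *: g + (1 - l) *: h).
Proof.
case: l => a b; rewrite !lecE /= => /andP[/eqP b0 a0] /andP[_ a1] fg fh k n kN nN.
have {b b0} -> : a +i* b = a%:C by rewrite b0.
have -> : 1 - a%:C = (1 - a)%:C by rewrite rmorphB.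
have -> : a%:C *: g + (1 - a)%:C *: h - f =
    a%:C *: (g - f) + (1 - a)%:C *: (h - f).
  by rewrite !scalerBr addrACA -opprD -scalerDl -rmorphD/= subrKC scale1r.
apply: le_lt_trans (seminormD _ _ _ _) _.
apply: le_lt_trans (lerD (seminormZ_le _ _ _ _) (seminormZ_le _ _ _ _)) _.
rewrite !normc_real !ger0_norm ?subr_ge0//.
have conv_lt (p q : R) : p < e -> q < e -> a * p + (1 - a) * q < e.
  move=> pe qe; have me : Num.max p q < e by rewrite gt_max pe qe.
  apply: le_lt_trans me; rewrite -[leRHS]mul1r -[X in _ <= X * _](subrKC a 1).
  rewrite [leRHS]mulrDl.
  by apply: lerD; apply: ler_wpM2l; rewrite ?subr_ge0// le_max lexx ?orbT.
by apply: conv_lt; [exact: fg k n kN nN|exact: fh k n kN nN].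
Qed.

Lemma schwartz_locally_convex : exists2 B : set_system (schwartz R),
  (forall b, b \in B -> @convex_set R[i] (schwartz R) b) & basis B.
Proof.
exists [set B | exists f N e, B = schwartz_ball f N e].
  move=> B /set_mem[f [N [e ->]]] g h l /set_mem fg /set_mem fh; apply/mem_set.
  exact: (schwartz_ball_conv (ge0 l) (le1 l) fg fh).
split; first by move=> _ [f [N [e ->]]]; exact: schwartz_ball_open.
move=> f U [N [e [e0 NU]]]; exists (schwartz_ball f N e) => //.
by split; [exists f, N, e | exact: schwartz_ball_center].
Qed.

HB.instance Definition _ :=
  PreTopologicalNmodule_isTopologicalNmodule.Build (schwartz R)
    schwartz_add_continuous.
HB.instance Definition _ :=
  TopologicalNmodule_isTopologicalLmodule.Build R[i] (schwartz R)
    schwartz_scale_continuous.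
(* This factory provides the uniform structure only. *)
HB.instance Definition _ := PreTopologicalLmod_isTvs.Build R[i] (schwartz R)
  schwartz_add_continuous schwartz_scale_continuous schwartz_locally_convex.
HB.instance Definition _ :=
  Uniform_isTvs.Build R[i] (schwartz R) schwartz_locally_convex.

End schwartz_topology.

Section moments.
Variable R : realType.

Lemma schwartz_mulXn n (f : R -> R[i]) :
  is_schwartz f -> is_schwartz (fun x => (x ^+ n)%:C * f x).
Proof.
move=> sf; elim: n => [|n IH].
  by rewrite (_ : (fun _ => _) = f)//; apply/funext => x; rewrite expr0 mul1r.
rewrite (_ : (fun _ => _) = mulX (fun x => (x ^+ n)%:C * f x)).
  exact: schwartz_mulX.
by apply/funext => x; rewrite /mulX exprS rmorphM mulrA.
Qed.

Definition mulXn n (phi : schwartz R) : schwartz R :=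
  Schwartz (mem_set (schwartz_mulXn n (set_mem (schwartzP phi)))).

Definition lin_span (K : nzRingType) (E : lmodType K) (I : Type) (u : I -> E) : set E :=
  [set v | exists s : seq (K * I), v = \sum_(p <- s) p.1 *: u p.2].

Definition total_family (I : Type) (u : I -> schwartz R) := dense (lin_span u).

(* The codomain is written R[i]^o because the modulus topology of R[i] is attached
   to that alias. *)
Definition tempered_distribution : set (schwartz R -> R[i]^o) :=
  [set T : schwartz R -> R[i]^o | scalar (T : schwartz R -> R[i]) /\ continuous T].

Definition weak_moment (phi : schwartz R) (T : schwartz R -> R[i]) n : R[i] :=
  T (mulXn n phi).

Definition gaussian_fun (c a : R) : R -> R[i] :=
  fun x => (c * expR (- a * x ^+ 2))%:C.

Lemma poly_gauss_derive (a : R) (p : {poly R}) (x : R) :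
  is_derive x (1 : R) (fun y : R => p.[y] * expR (- a * y ^+ 2))
    ((p^`() - (a *+ 2) *: ('X * p)).[x] * expR (- a * x ^+ 2)).
Proof.
have dq : is_derive x (1 : R) (fun y : R => - a * y ^+ 2) (- a * (x *+ 2)).
  have -> : (fun y : R => - a * y ^+ 2) = (- a) *: (@id R ^+ 2).
    by apply/funext => y.
  apply: is_derive_eq.
  by rewrite /GRing.scale/= expr1 mulr1 mulr_natl.
have de : is_derive x (1 : R) (fun y : R => expR (- a * y ^+ 2))
    (- a * (x *+ 2) * expR (- a * x ^+ 2)).
  rewrite mulrC.
  exact: (@is_derive1_comp R expR (fun y : R => - a * y ^+ 2) x _ _
    (is_derive_expR (- a * x ^+ 2)) dq).
have h := is_deriveM (is_derive_poly p x) de.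
refine (@is_derive_eq _ _ _ _ _ _ _ _ h _); rewrite /GRing.scale/=.
by move: (expR _) => E; rewrite hornerD hornerN hornerZ hornerM hornerX; ring.
Qed.

Lemma monomial_gauss_le (a x : R) j : 0 < a ->
  `|x| ^+ j * expR (- a * x ^+ 2) <= 1 + j`!%:R / a ^+ j.
Proof.
move=> a0.
have ax0 : 0 <= a * x ^+ 2 by rewrite mulr_ge0 ?sqr_ge0 ?ltW.
rewrite mulNr expRN ler_pdivrMr ?expR_gt0//.
have E1 : 1 <= expR (a * x ^+ 2) by rewrite -expR0 ler_expR.
have Ej : (x ^+ 2) ^+ j <= j`!%:R / a ^+ j * expR (a * x ^+ 2).
  rewrite mulrAC ler_pdivlMr ?exprn_gt0// -exprMn [x ^+ 2 * a]mulrC.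
  rewrite -ler_pdivrMl ?ltr0n ?fact_gt0//.
  case: j => [|j]; first by rewrite expr0 fact0 invr1 mul1r.
  have := expR_ge1Dxn j ax0; apply: le_trans.
  rewrite [leLHS]mulrC; set y := _ / _; lra.
rewrite mulrDl mul1r; apply: le_trans (lerD E1 Ej).
rewrite -real_normK ?num_real// -exprM mulnC exprM.
have := normr_ge0 x; move: `|x| => y y0; have := exprn_ge0 j y0.
by move: (y ^+ j) => t t0; have := sqr_ge0 (t - 1); nra.
Qed.

Lemma poly_gauss_bounded (a : R) (p : {poly R}) : 0 < a ->
  exists M : R, forall x : R, `|p.[x] * expR (- a * x ^+ 2)| <= M.
Proof.
move=> a0; exists (\sum_(i < size p) `|p`_i| * (1 + i`!%:R / a ^+ i)) => x.
rewrite horner_coef mulr_suml (le_trans (ler_norm_sum _ _ _))//.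
apply: ler_sum => i _; rewrite !normrM -mulrA ler_wpM2l//.
by rewrite normrX (ger0_norm (expR_ge0 _)) monomial_gauss_le.
Qed.

Lemma gaussian_schwartz (c a : R) : 0 < a -> is_schwartz (gaussian_fun c a).
Proof.
move=> a0.
have Re_g : @Re R \o gaussian_fun c a = (fun x => c * expR (- a * x ^+ 2)) by [].
have Im_g : @Im R \o gaussian_fun c a = (fun x => 0) by [].
have dRe n : exists p : {poly R}, derive1n n (fun x : R => c * expR (- a * x ^+ 2))
    = (fun x => p.[x] * expR (- a * x ^+ 2)).
  elim: n => [|n [p IH]].
    by exists c%:P; apply/funext => x; rewrite derive1n0 hornerC.
  exists (p^`() - (a *+ 2) *: ('X * p)); rewrite derive1nS IH; apply/funext => x.
  by rewrite derive1E; have := poly_gauss_derive a p x => h; rewrite derive_val.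
have dIm n : derive1n n (fun x : R => 0 : R) = (fun x => 0).
  by elim: n => [//|n IH]; rewrite derive1nS IH; apply/funext => x; exact: derive1_cst.
split.
  split => n x; last by rewrite Im_g dIm; exact: derivable_cst.
  rewrite Re_g; have [p ->] := dRe n.
  by have [] := poly_gauss_derive a p x.
move=> k n; have [p pE] := dRe n; have [M pM] := poly_gauss_bounded ('X^k * p) a0.
exists M => x; apply: le_trans (pM x).
rewrite /cderiv1n Re_g Im_g dIm pE normc_real hornerM hornerXn -mulrA.
by rewrite [leRHS]normrM normrX.
Qed.

Definition gaussian (c a : R) (a0 : 0 < a) : schwartz R :=
  Schwartz (mem_set (gaussian_schwartz c a0)).

End moments.

(* Main.v *)
(* Let [w x = expR (- a * x ^+ 2)]. The Taylor polynomials of [expR (- d * x ^+ 2)]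
   converge to it uniformly in the weight [expR (- 3 * d * x ^+ 2)], so every
   power of [u = expR (- d * x ^+ 2)] is a weighted uniform limit of polynomials;
   by Weierstrass' theorem in the variable [u], so is every even continuous
   function vanishing at infinity. A real Schwartz function [f] is first truncated
   to [f * G] with [G x = expR (- (s * x) ^+ 4)], so that [h = f * G / w] is still
   Schwartz. For [f] even or odd and [K] of the same parity, the K-th derivative of
   [h] is even, hence approximated by a polynomial; integrating [K] times gives a
   polynomial [p] such that [p * w] is close to [f * G] in the Schwartz topology.
   Determinacy of the moment problem follows since a continuous linear form is
   determined by its values on a total family. *)

Require Import Defs.
From mathcomp Require Import all_boot all_order all_algebra.
From mathcomp Require Import all_classical all_reals all_analysis.
From mathcomp Require Import complex ring lra.

Set Implicit Arguments.
Unset Strict Implicit.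
Unset Printing Implicit Defensive.

Import Order.TTheory GRing.Theory Num.Theory.
Import numFieldNormedType.Exports.

Local Open Scope ring_scope.
Local Open Scope classical_set_scope.
Local Open Scope complex_scope.

(** * Weierstrass' theorem *)

Section weierstrass.
Variable R : realType.
Implicit Types (f : R -> R) (g : nat -> R).

(* De Casteljau recursion; [bernstein m g] is
   \sum_(k <= m) 'C(m, k) * g k * 'X^k * (1 - 'X)^(m - k). *)
Fixpoint bernstein (m : nat) g : {poly R} :=
  if m is m'.+1 then (1 - 'X) * bernstein m' g + 'X * bernstein m' (g \o S)
  else (g 0%N)%:P.

(* [(m * u - d)^2 + m * u * (1 - u)] is the second moment about [d] of the
   binomial law with parameters [m] and [u]. *)
Lemma bernstein_dist (m : nat) g (h c K d u : R) : 0 <= u -> u <= 1 ->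
  (forall k, (k <= m)%N -> `|g k - h| <= c + K * (k%:R - d) ^+ 2) ->
  `|(bernstein m g).[u] - h|
    <= c + K * ((m%:R * u - d) ^+ 2 + m%:R * u * (1 - u)).
Proof.
move=> u0 u1; elim: m g d => [|m IH] g d gh /=.
  by rewrite hornerC !mul0r addr0; exact: gh.
rewrite !hornerE.
have v0 : 0 <= 1 - u by rewrite subr_ge0.
have E1 : `|(bernstein m g).[u] - h|
    <= c + K * ((m%:R * u - d) ^+ 2 + m%:R * u * (1 - u)).
  by apply: IH => k km; apply: gh; exact: leqW.
have E2 : `|(bernstein m (g \o S)).[u] - h|
    <= c + K * ((m%:R * u - (d - 1)) ^+ 2 + m%:R * u * (1 - u)).
  apply: IH => k km; apply: le_trans (gh k.+1 km) _.
  by rewrite -natr1 opprB addrA.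
have -> : (1 - u) * (bernstein m g).[u] + u * (bernstein m (g \o S)).[u] - h =
  (1 - u) * ((bernstein m g).[u] - h) + u * ((bernstein m (g \o S)).[u] - h).
  by ring.
apply: le_trans (ler_normD _ _) _.
rewrite !normrM (ger0_norm u0) (ger0_norm v0).
apply: le_trans (lerD (ler_wpM2l v0 E1) (ler_wpM2l u0 E2)) _.
by rewrite -natr1 le_eqVlt; apply/orP; left; apply/eqP; ring.
Qed.

Lemma segment_unif_continuous f (a b e : R) : continuous f -> 0 < e ->
  exists2 d, 0 < d & forall x y, a <= x <= b -> `|x - y| < d -> `|f x - f y| < e.
Proof.
move=> cf e0.
have := (compact_near_coveringP _).1 (@segment_compact R a b).
move=> /(_ R (0^'+) (fun d x => forall y, `|x - y| < d -> `|f x - f y| < e) _).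
case=> [x _|d /= d0 H].
  have e20 : 0 < e / 2 by rewrite divr_gt0.
  have /cvgrPdist_lt/(_ _ e20)[d /= d0 dP] := cf x.
  exists (ball x (d / 2), [set t | t < d / 2]) => /=.
    split; first by apply: nbhsx_ballx; rewrite divr_gt0.
    by apply: nbhs_right_lt; rewrite divr_gt0.
  move=> [x' t] /= [xx' td] y x'y.
  have E1 : `|f x - f x'| < e / 2.
    by apply: dP => /=; apply: lt_trans xx' _; rewrite ltr_pdivrMr// ltr_pMr// ltr1n.
  have E2 : `|f x - f y| < e / 2.
    apply: dP => /=; rewrite -(subrKA x') [d]splitr.
    apply: le_lt_trans (ler_normD _ _) _; apply: ltrD => //.
    exact: lt_trans x'y td.
  rewrite -(subrKA (f x)) [e]splitr; apply: le_lt_trans (ler_normD _ _) _.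
  by rewrite distrC; apply: ltrD.
exists (d / 2) => [|x y xab]; first by rewrite divr_gt0.
apply: (H (d / 2)) => //=; last by rewrite divr_gt0.
  by rewrite /ball/= sub0r normrN gtr0_norm ?divr_gt0// ltr_pdivrMr// ltr_pMr// ltr1n.
Qed.

(** Bernstein's argument: [f] deviates from [f u] by at most [e / 2] plus a multiple of the squared
    distance to [u], and the Bernstein average of that square is a binomial variance, which tends to
    0 as the degree grows. *)
Lemma weierstrass_unit_segment f (e : R) : continuous f -> 0 < e ->
  exists p : {poly R}, forall u, 0 <= u <= 1 -> `|f u - p.[u]| <= e.
Proof.
move=> cf e0; have e20 : 0 < e / 2 by rewrite divr_gt0.
have [d d0 fd] := @segment_unif_continuous f 0 1 _ cf e20.
have [M M1 fM] : exists2 M, 0 < M & forall u, 0 <= u <= 1 -> `|f u| <= M.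
  have [|c _ cP] := @EVT_max R (fun x => `|f x|) 0 1 ler01.
    apply: continuous_subspaceT => x.
    exact: (@cvg_norm _ _ _ _ _ f _ (cf x)).
  exists (`|f c| + 1) => [|u u01]; first by rewrite ltr_wpDl.
  by rewrite (le_trans (cP u _)) ?lerDl// in_itv.
(* Beyond distance [d] the term [K * (v - u) ^+ 2] is at least [M *+ 2], which bounds any difference
   of values of [f] on the segment. *)
pose K := (M *+ 2) / d ^+ 2.
have K0 : 0 <= K by rewrite divr_ge0 ?sqr_ge0// mulrn_wge0// ltW.
have fK u v : 0 <= u <= 1 -> 0 <= v <= 1 ->
    `|f v - f u| <= e / 2 + K * (v - u) ^+ 2.
  move=> u01 v01; have [uv|uv] := ltP `|u - v| d.
    rewrite distrC (le_trans (ltW (fd _ _ u01 uv)))// lerDl.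
    by rewrite mulr_ge0 ?sqr_ge0.
  apply: le_trans (ler_normB _ _) _.
  apply: le_trans (lerD (fM _ v01) (fM _ u01)) _.
  rewrite -[leLHS]add0r; apply: lerD; first exact: ltW.
  rewrite /K mulrAC ler_pdivlMr ?exprn_gt0// mulr2n.
  apply: ler_wpM2l; first by rewrite addr_ge0// ltW.
  rewrite -[leRHS]real_normK ?num_real// distrC.
  by rewrite ler_pXn2r ?nnegrE// ltW.
have [m mK] : exists m : nat, K / (e / 2) < m.+1%:R.
  exists (Num.trunc (K / (e / 2))).
  by have /andP[] := truncn_itv (divr_ge0 K0 (ltW e20)).
exists (bernstein m.+1 (fun k => f (k%:R / m.+1%:R))) => u u01.
have /andP[u0 u1] := u01; rewrite distrC.
have mp : (0 : R) < m.+1%:R by rewrite ltr0n.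
have H k : (k <= m.+1)%N -> `|f (k%:R / m.+1%:R) - f u|
    <= e / 2 + K / m.+1%:R ^+ 2 * (k%:R - m.+1%:R * u) ^+ 2.
  move=> km; have k01 : 0 <= (k%:R / m.+1%:R : R) <= 1.
    by rewrite divr_ge0//= ler_pdivrMr// mul1r ler_nat.
  apply: le_trans (fK _ _ u01 k01) _; rewrite lerD2l.
  rewrite le_eqVlt; apply/orP; left; apply/eqP; field.
  by rewrite nat1r gt_eqF.
apply: le_trans (bernstein_dist u0 u1 H) _.
(* The nodes are centred at their mean [m.+1%:R * u], so the squared bias vanishes and only the
   variance is left. *)
rewrite subrr expr0n/= add0r [leRHS]splitr lerD2l.
have -> : K / m.+1%:R ^+ 2 * (m.+1%:R * u * (1 - u)) =
   K / m.+1%:R * (u * (1 - u)) by field; rewrite nat1r gt_eqF.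
have uu : u * (1 - u) <= 1 by nra.
apply: le_trans (ler_wpM2l _ uu) _; first by rewrite divr_ge0.
by rewrite mulr1 ler_pdivrMr// mulrC -ler_pdivrMr// ltW.
Qed.

End weierstrass.

(** * Polynomial approximation in a Gaussian weight *)

Section gauss_weight.
Variable R : realType.
Implicit Types (g : R -> R) (p : {poly R}).

(** For [i >= n] one has [|x|^i <= 2^-n * (2 * |x|)^i], so the tail of the series at [x] is
    dominated termwise by [2^-n] times the series at [2 * |x|]. *)
Lemma expR_taylor_dist (n : nat) (x : R) :
  `|expR x - series (exp_coeff x) n| <= 2^-1 ^+ n * expR (2 * `|x|).
Proof.
have cx (y : R) : series (exp_coeff y) k @[k --> \oo] --> expR y.
  exact: is_cvg_series_exp_coeff.
have cl : `|series (exp_coeff x) k - series (exp_coeff x) n| @[k --> \oo] -->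
    `|expR x - series (exp_coeff x) n|.
  by apply: cvg_norm; apply: cvgB => //; exact: cvg_cst.
have cr : 2^-1 ^+ n * series (exp_coeff (2 * `|x|)) k @[k --> \oo] -->
    2^-1 ^+ n * expR (2 * `|x|).
  by apply: cvgM => //; exact: cvg_cst.
apply: (ler_cvg_to cl cr); near=> k.
have nk : (n <= k)%N by near: k; exact: nbhs_infty_ge.
rewrite /series/= (@big_cat_nat _ _ _ n)//= addrAC subrr add0r.
apply: le_trans (ler_norm_sum _ _ _) _.
rewrite [X in _ <= _ * X](@big_cat_nat _ _ _ n)//= mulrDr ler_wpDl//.
  apply: mulr_ge0 => //; apply: sumr_ge0 => i _.
  by rewrite /exp_coeff/= divr_ge0// exprn_ge0// mulr_ge0.
rewrite mulr_sumr big_nat_cond [leRHS]big_nat_cond; apply: ler_sum => i.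
rewrite andbT => /andP[ni _].
rewrite /exp_coeff/= normrM normfV normr_nat mulrA ler_wpM2r ?invr_ge0//.
rewrite exprMn normrX mulrA ler_peMl ?exprn_ge0//.
by rewrite exprVn mulrC -expfB_cond ?pnatr_eq0//= exprn_ege1// ler1n.
Unshelve. all: by end_near. Qed.

Definition gauss_approx (b : R) g := forall e : R, 0 < e ->
  exists p : {poly R}, forall x, `|g x - p.[x]| * expR (- b * x ^+ 2) <= e.

Lemma gauss_approx_closed (b : R) g :
  (forall e : R, 0 < e -> exists2 h, gauss_approx b h &
    forall x, `|g x - h x| * expR (- b * x ^+ 2) <= e) -> gauss_approx b g.
Proof.
move=> H e e0; have e20 : 0 < e / 2 by rewrite divr_gt0.
have [h /(_ _ e20)[p hp] gh] := H _ e20; exists p => x.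
rewrite -(subrKA (h x)) [e]splitr.
apply: le_trans (ler_wpM2r (expR_ge0 _) (ler_normD _ _)) _.
by rewrite mulrDl lerD.
Qed.

Lemma gauss_approx0 b : gauss_approx b (fun=> 0).
Proof. by move=> e e0; exists 0 => x; rewrite horner0 subrr normr0 mul0r ltW. Qed.

Lemma gauss_approxD (b : R) g h : gauss_approx b g -> gauss_approx b h ->
  gauss_approx b (fun x => g x + h x).
Proof.
move=> gb hb e e0; have e20 : 0 < e / 2 by rewrite divr_gt0.
have [p gp] := gb _ e20; have [q hq] := hb _ e20; exists (p + q) => x.
rewrite hornerD opprD addrACA [e]splitr.
apply: le_trans (ler_wpM2r (expR_ge0 _) (ler_normD _ _)) _.
by rewrite mulrDl lerD.
Qed.

Lemma gauss_approx_sum (b : R) n (g : nat -> R -> R) :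
  (forall i, (i < n)%N -> gauss_approx b (g i)) ->
  gauss_approx b (fun x => \sum_(i < n) g i x).
Proof.
elim: n => [|n IH] gb.
  rewrite (_ : (fun _ => _) = fun=> 0); first exact: gauss_approx0.
  by apply/funext => x; rewrite big_ord0.
rewrite (_ : (fun _ => _) = fun x => \sum_(i < n) g i x + g n x).
  by apply: gauss_approxD; [apply: IH => i /ltnW; exact: gb | exact: gb].
by apply/funext => x; rewrite big_ord_recr.
Qed.

(* Replacing one factor [expR (- d * x ^+ 2)] by its Taylor polynomial costs
   [2^-n * expR (2 * d * x ^+ 2)], which the weight absorbs. *)
Lemma gauss_approx_gaussian (d : R) p k : 0 < d ->
  gauss_approx (3 * d) (fun x => p.[x] * expR (- d * x ^+ 2) ^+ k).
Proof.
move=> d0; elim: k p => [|k IH] p.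
  move=> e e0; exists p => x.
  by rewrite expr0 mulr1 subrr normr0 mul0r ltW.
apply: gauss_approx_closed => e e0.
have [M pM] := poly_gauss_bounded p d0.
have M0 : 0 <= M by exact: le_trans (normr_ge0 _) (pM 0).
have [n nM] : exists n, 2^-1 ^+ n * M <= e.
  have : 2^-1 ^+ n * M @[n --> \oo] --> 0 * M.
    apply: cvgM; last exact: cvg_cst.
    by apply: cvg_expr; rewrite ger0_norm// invf_lt1// ltr1n.
  rewrite mul0r => /cvgrPdist_le/(_ _ e0)[n _ /(_ n (leqnn n))].
  rewrite sub0r normrN ger0_norm; first by exists n.
  by rewrite mulr_ge0.
pose T : {poly R} := \sum_(0 <= i < n) (i`!%:R)^-1 *: (- d *: 'X^2) ^+ i.
have TE x : T.[x] = series (exp_coeff (- d * x ^+ 2)) n.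
  rewrite /T horner_sum /series/=; apply: eq_bigr => i _.
  by rewrite /exp_coeff/= hornerZ horner_exp hornerZ hornerXn mulrC.
exists (fun x => (p * T).[x] * expR (- d * x ^+ 2) ^+ k) => [|x]; first exact: IH.
rewrite exprSr hornerM TE.
set E := expR (- d * x ^+ 2); set s := series _ _.
have -> : p.[x] * (E ^+ k * E) - p.[x] * s * E ^+ k = p.[x] * E ^+ k * (E - s) by ring.
have x20 := sqr_ge0 x.
have Ek : E ^+ k <= 1.
  by rewrite exprn_ile1 ?expR_ge0// expR_le1 mulNr oppr_le0 mulr_ge0// ltW.
have H : `|E - s| <= 2^-1 ^+ n * expR (2 * (d * x ^+ 2)).
  have := expR_taylor_dist n (- d * x ^+ 2).
  rewrite (_ : `|- d * x ^+ 2| = d * x ^+ 2)//.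
  by rewrite mulNr normrN ger0_norm// mulr_ge0// ltW.
rewrite !normrM.
(* Of the weight [3 * d], the part [2 * d] absorbs the Taylor error and the remaining [d] keeps [p]
   bounded by [M]. *)
have E3 : expR (2 * (d * x ^+ 2)) * expR (- (3 * d) * x ^+ 2) = E.
  by rewrite -expRD; congr expR; ring.
rewrite (ger0_norm (exprn_ge0 _ (expR_ge0 _))).
apply: le_trans nM.
apply: (@le_trans _ _ (`|p.[x]| * 1 * (2^-1 ^+ n * expR (2 * (d * x ^+ 2)))
   * expR (- (3 * d) * x ^+ 2))).
  apply: ler_wpM2r; first exact: expR_ge0.
  by rewrite ler_pM ?mulr_ge0 ?exprn_ge0 ?expR_ge0// ler_wpM2l.
rewrite mulr1 -mulrA -(mulrA (2^-1 ^+ n)) E3 mulrCA ler_wpM2l//.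
by have := pM x; rewrite normrM (ger0_norm (expR_ge0 _)).
Qed.

(** Evenness makes [g] a function [h] of [u = expR (- d * x ^+ 2)], and decay makes [h] continuous
    at [u = 0]. Weierstrass' theorem then gives a polynomial in [u], each power of which is
    approximable in the weight [3 * d = b]. *)
Lemma gauss_approx_even (b C : R) g : 0 < b -> continuous g ->
  (forall x, g (- x) = g x) -> (forall x, `|x| * `|g x| <= C) ->
  gauss_approx b g.
Proof.
move=> b0 cg ge gC; pose d := b / 3.
have d0 : 0 < d by rewrite divr_gt0.
have -> : b = 3 * d by rewrite mulrC divfK// pnatr_eq0.
(* [Num.sqrt (- ln u / d)] inverts [expR (- d * x ^+ 2)] on [x >= 0]; the extension by 0 makes [h]
   continuous on the whole line. *)
pose h u := if 0 < u then g (Num.sqrt (- ln u / d)) else 0.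
have hE x : h (expR (- d * x ^+ 2)) = g x.
  rewrite /h expR_gt0 expRK (_ : - _ / d = x ^+ 2); last by field; rewrite gt_eqF.
  rewrite sqrtr_sqr.
  by case: (ger0P x) => // _; rewrite ge.
have ch : continuous h.
  move=> u; have [u0|u0|->] := ltgtP u 0.
  - have hu : h u = 0 by rewrite /h ltNge ltW.
    rewrite /continuous_at hu; apply/cvgrPdist_le => e e0; near=> v.
    rewrite /h ifF ?subrr ?normr0 ?(ltW e0)//; apply/negbTE; rewrite -leNgt ltW//.
    by near: v; exact: lt_nbhsl.
  - have : {for u, continuous (g \o (fun v => Num.sqrt (- ln v / d)))}.
      apply: continuous_comp; last exact: cg.
      apply: (@continuous_comp _ _ _ (fun v => - ln v / d) Num.sqrt).
        by apply: cvgM; [exact: cvgN (continuous_ln u0)|exact: cvg_cst].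
      exact: sqrt_continuous.
    have hu : h u = g (Num.sqrt (- ln u / d)) by rewrite /h u0.
    rewrite /continuous_at hu; apply: cvg_trans.
    apply: near_eq_cvg; near=> v; rewrite /h /= ifT//.
    by near: v; exact: lt_nbhsr.
  - have h0 : h 0 = 0 by rewrite /h ltxx.
    rewrite /continuous_at h0; apply/cvgrPdist_le => e e0.
    (* Here [C <= r * e], so [|g x| <= e] as soon as [r <= x]; this holds once [v] is below
       [expR (- d * r ^+ 2)]. *)
    pose r := `|C| / e + 1.
    have r0 : 0 < r by rewrite ltr_wpDl// divr_ge0// ltW.
    have vr : (0 : R) < expR (- d * r ^+ 2) by exact: expR_gt0.
    near=> v; rewrite sub0r normrN /h; case: ifPn => v0; last by rewrite normr0 ltW.
    set x := Num.sqrt _.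
    have rx : r <= x.
      rewrite -[r]gtr0_norm// -sqrtr_sqr ler_wsqrtr// ler_pdivlMr// mulrC lerNr -mulNr.
      rewrite -[leRHS]expRK ler_ln ?posrE ?expR_gt0// ltW//; near: v.
      exact: lt_nbhsl.
    rewrite -(ler_pM2l r0); apply: (@le_trans _ _ (`|x| * `|g x|)).
      by rewrite ler_wpM2r// (le_trans rx)// ler_norm.
    apply: le_trans (gC x) _; apply: le_trans (ler_norm C) _.
    by rewrite mulrDl mul1r divfK ?gt_eqF// lerDl ltW.
apply: gauss_approx_closed => e e0.
have [q hq] := weierstrass_unit_segment ch e0.
exists (fun x => q.[expR (- d * x ^+ 2)]) => [|x].
  rewrite (_ : (fun _ => _) = fun x => \sum_(i < size q)
    (q`_i)%:P.[x] * expR (- d * x ^+ 2) ^+ i).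
    apply: (@gauss_approx_sum _ _
      (fun i x => (q`_i)%:P.[x] * expR (- d * x ^+ 2) ^+ i)) => i _.
    exact: gauss_approx_gaussian.
  by apply/funext => x; rewrite horner_coef; apply: eq_bigr => i _; rewrite hornerC.
have x20 := sqr_ge0 x.
have u1 c : 0 <= c -> expR (- c * x ^+ 2) <= 1.
  by move=> c0; rewrite expR_le1 mulNr oppr_le0 mulr_ge0.
apply: (@le_trans _ _ (e * 1)); last by rewrite mulr1.
apply: ler_pM; rewrite ?expR_ge0//; last by apply: u1; rewrite mulr_ge0// ltW.
by rewrite -hE hq// expR_ge0 u1// ltW.
Unshelve. all: by end_near. Qed.

End gauss_weight.

(** * Smooth functions *)

Section smooth_calculus.
Variable R : realType.
Implicit Types (f g : R -> R) (p q : {poly R}).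

Lemma smooth_is_derive f n x : smooth f ->
  is_derive x (1 : R) (derive1n n f) (derive1n n.+1 f x).
Proof. by move=> sf; rewrite derive1nS derive1E; exact/derivableP/sf. Qed.

Lemma smooth_continuous f n : smooth f -> continuous (derive1n n f).
Proof.
by move=> sf x; apply: differentiable_continuous; exact/derivable1_diffP/sf.
Qed.

Lemma smooth_derive1 f : smooth f -> smooth (derive1 f).
Proof. by move=> sf n x; rewrite -derive1Sn; exact: sf. Qed.

(** Smoothness by invariance: iterated derivatives never leave the class, so no formula for them is
    required. *)
Lemma derive1_closed_smooth (P : (R -> R) -> Prop) :
  (forall f, P f -> (forall x, derivable f x 1) /\ P (derive1 f)) ->
  forall f, P f -> smooth f.
Proof.
move=> PP f Pf n; suff : P (derive1n n f) by case/PP.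
by elim: n => // n /PP[].
Qed.

Lemma smooth_derive1M f g : smooth f -> smooth g ->
  derive1 (fun x => f x * g x) = (fun x => derive1 f x * g x + f x * derive1 g x).
Proof.
move=> sf sg; apply/funext => x; rewrite !derive1E (deriveM (sf 0%N x) (sg 0%N x)).
by rewrite addrC /GRing.scale/= [g x * _]mulrC.
Qed.

(** Products alone are not stable under differentiation, but their finite sums are, by the product
    rule. *)
Inductive sum_of_smooth_products : (R -> R) -> Prop :=
| SmoothProduct f g : smooth f -> smooth g ->
    sum_of_smooth_products (fun x => f x * g x)
| SmoothProductD f g : sum_of_smooth_products f -> sum_of_smooth_products g ->
    sum_of_smooth_products (fun x => f x + g x).

Lemma smoothM f g : smooth f -> smooth g -> smooth (fun x => f x * g x).
Proof.
move=> sf sg; apply: (derive1_closed_smooth (P := sum_of_smooth_products)).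
  move=> h; elim=> {h}[h k sh sk|h k _ [dh ih] _ [dk ik]].
    split=> [x|]; first exact: derivableM (sh 0%N x) (sk 0%N x).
    rewrite (smooth_derive1M sh sk).
    exact (SmoothProductD (SmoothProduct (smooth_derive1 sh) sk)
                          (SmoothProduct sh (smooth_derive1 sk))).
  split=> [x|]; first exact: derivableD.
  rewrite (_ : derive1 _ = fun x => derive1 h x + derive1 k x).
    exact (SmoothProductD ih ik).
  by apply/funext => x; rewrite !derive1E deriveD.
exact (SmoothProduct sf sg).
Qed.

Lemma smoothB f g : smooth f -> smooth g -> smooth (fun x => f x - g x).
Proof.
move=> sf sg; rewrite (_ : (fun _ => _) = fun x => f x + -1 * g x).
  exact (smoothD sf (smoothZ (a := -1) sg)).
by apply/funext => x; rewrite mulN1r.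
Qed.

Lemma derive1nB f g n : smooth f -> smooth g ->
  derive1n n (fun x => f x - g x) = (fun x => derive1n n f x - derive1n n g x).
Proof.
move=> sf sg; rewrite (_ : (fun _ => _) = fun x => f x + -1 * g x).
  rewrite (smoothD_derive n sf (smoothZ (a := -1) sg)) (smoothZ_derive (-1) n sg).
  by apply/funext => x; rewrite mulN1r.
by apply/funext => x; rewrite mulN1r.
Qed.

(* Weak form of Leibniz' rule, at a single point. *)
Lemma derive1nM_le n f g (A B x : R) : smooth f -> smooth g -> 0 <= A -> 0 <= B ->
  (forall i, (i <= n)%N -> `|derive1n i f x| <= A) ->
  (forall i, (i <= n)%N -> `|derive1n i g x| <= B) ->
  `|derive1n n (fun y => f y * g y) x| <= 2 ^+ n * (A * B).
Proof.
elim: n f g => [|n IH] f g sf sg A0 B0 fA gB.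
  rewrite derive1n0 expr0 mul1r normrM.
  by apply: ler_pM => //; [exact: (fA 0%N)|exact: (gB 0%N)].
have sf' := smooth_derive1 sf; have sg' := smooth_derive1 sg.
rewrite derive1Sn (smooth_derive1M sf sg).
rewrite (smoothD_derive n (smoothM sf' sg) (smoothM sf sg')).
apply: le_trans (ler_normD _ _) _.
rewrite exprS -mulrA mulr_natl mulr2n; apply: lerD.
  apply: IH => // i ni; first by rewrite -derive1Sn; exact: fA.
  by apply: gB; exact: leqW.
apply: IH => // i ni; last by rewrite -derive1Sn; exact: gB.
by apply: fA; exact: leqW.
Qed.

Lemma is_derive_scale f (s x : R) n : smooth f ->
  is_derive x (1 : R) (fun y => s ^+ n * derive1n n f (s * y))
    (s ^+ n.+1 * derive1n n.+1 f (s * x)).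
Proof.
move=> sf.
have ds : is_derive x (1 : R) (fun y : R => s * y) s.
  have h := @is_deriveZ R R^o R^o id s x 1 _ (is_derive_id x (1 : R)).
  by apply: (is_derive_eq h); rewrite /GRing.scale/= mulr1.
have h := is_derive1_comp (smooth_is_derive n (s * x) sf) ds.
have h' := @is_deriveZ R R^o R^o _ (s ^+ n) x 1 _ h.
by apply: (is_derive_eq h'); rewrite exprSr mulrAC -mulrA.
Qed.

Lemma derive1n_scale f (s : R) n : smooth f ->
  derive1n n (fun x => f (s * x)) = (fun x => s ^+ n * derive1n n f (s * x)).
Proof.
move=> sf; elim: n => [|n IH].
  by apply/funext => x; rewrite expr0 mul1r.
rewrite derive1nS IH; apply/funext => x; rewrite derive1E.
by have [_] := is_derive_scale s x n sf.
Qed.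

Lemma smooth_scale f (s : R) : smooth f -> smooth (fun x => f (s * x)).
Proof.
by move=> sf n x; rewrite (derive1n_scale s n sf); have [] := is_derive_scale s x n sf.
Qed.

(** For fixed [q] this family is stable under differentiation; it covers polynomials ([q = 0]),
    Gaussians and the quartic cutoff. *)
Definition poly_exp p q (x : R) : R := p.[x] * expR q.[x].

Lemma is_derive_poly_exp p q x :
  is_derive x (1 : R) (poly_exp p q) (poly_exp (p^`() + p * q^`()) q x).
Proof.
have de := is_derive1_comp (is_derive_expR q.[x]) (is_derive_poly q x).
have h := is_deriveM (is_derive_poly p x) de.
apply: (is_derive_eq h).
by rewrite /poly_exp /GRing.scale/= hornerD hornerM; ring.
Qed.

Lemma derive1n_poly_exp p q n :
  exists r, derive1n n (poly_exp p q) = poly_exp r q.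
Proof.
elim: n => [|n [r IH]]; first by exists p.
exists (r^`() + r * q^`()); rewrite derive1nS IH; apply/funext => x.
by rewrite derive1E; apply: derive_val; exact: is_derive_poly_exp.
Qed.

Lemma smooth_poly_exp p q : smooth (poly_exp p q).
Proof.
by move=> n x; have [r ->] := derive1n_poly_exp p q n;
  have [] := is_derive_poly_exp r q x.
Qed.

Lemma smooth_horner p : smooth (horner p).
Proof.
rewrite (_ : horner p = poly_exp p 0); first exact: smooth_poly_exp.
by apply/funext => x; rewrite /poly_exp horner0 expR0 mulr1.
Qed.

(** The point [t] is located only through [|t|], because the bounds later evaluated at [t] are
    nondecreasing in [|t|]. *)
Lemma smooth_MVT f (x y : R) : smooth f -> exists2 t, `|t| <= Num.max `|x| `|y| &
  f x - f y = derive1 f t * (x - y).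
Proof.
move=> sf; wlog yx : x y / y <= x.
  move=> H; have [/H//|/ltW /H[t txy E]] := leP y x.
  by exists t; [rewrite maxC|rewrite -opprB E -mulrN opprB].
have [||t] := @MVT_segment R f (derive1 f) y x yx.
- by move=> z _; exact: (smooth_is_derive 0 z sf).
- by apply: continuous_subspaceT; exact: (smooth_continuous (n := 0) sf).
rewrite in_itv/= => /andP[yt tx] E; exists t => //.
rewrite le_max; case: (ger0P t) => t0.
  by rewrite (ger0_norm (le_trans t0 tx)) tx.
by rewrite (ltr0_norm (le_lt_trans yt t0)) !lerN2 yt orbT.
Qed.

End smooth_calculus.

(** * Approximation of real Schwartz functions *)

Section real_approximation.
Variable R : realType.
Implicit Types (f g h : R -> R) (p q : {poly R}).

Lemma uniform_bound (P : nat -> R -> Prop) N :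
  (forall i M M', M <= M' -> P i M -> P i M') -> (forall i, exists M, P i M) ->
  exists2 M, 0 <= M & forall i, (i <= N)%N -> P i M.
Proof.
move=> mP eP; elim: N => [|N [M M0 HM]].
  have [M HM] := eP 0%N; exists (Num.max 0 M); first by rewrite le_max lexx.
  move=> i; rewrite leqn0 => /eqP->; apply: mP HM.
  by rewrite le_max lexx orbT.
have [M' HM'] := eP N.+1; exists (Num.max M M'); first by rewrite le_max M0.
move=> i; rewrite leq_eqVlt => /predU1P[->|]; rewrite ?ltnS.
  by apply: mP HM'; rewrite le_max lexx orbT.
by move=> /HM; apply: mP; rewrite le_max lexx.
Qed.

Lemma exprD1_le (t : R) K : 0 <= t -> (1 + t) ^+ K <= 2 ^+ K * (1 + t ^+ K).
Proof.
move=> t0; have [t1|/ltW t1] := leP t 1.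
  apply: (@le_trans _ _ (2 ^+ K)).
    rewrite lerXn2r// ?nnegrE ?addr_ge0//.
    by rewrite [leRHS](_ : 2 = 1 + 1)// lerD2l.
  by rewrite ler_peMr ?exprn_ge0// lerDl exprn_ge0.
apply: (@le_trans _ _ ((2 * t) ^+ K)).
  rewrite lerXn2r// ?nnegrE ?addr_ge0 ?mulr_ge0//.
  by rewrite mulr_natl mulr2n lerD2r.
by rewrite exprMn ler_wpM2l ?exprn_ge0// lerDr.
Qed.

Lemma poly_exp_bounded (C : R) p q : (forall x, q.[x] <= C - x ^+ 2) ->
  exists M, forall x, `|poly_exp p q x| <= M.
Proof.
move=> qC; have [M pM] := poly_gauss_bounded p (@ltr01 R).
exists (expR C * M) => x.
apply: le_trans (ler_wpM2l (expR_ge0 C) (pM x)).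
rewrite /poly_exp !normrM !(ger0_norm (expR_ge0 _)) mulrCA ler_wpM2l//.
by rewrite -expRD ler_expR mulN1r.
Qed.

Lemma derive1n_poly_exp_bounded (C : R) p q N :
  (forall x, q.[x] <= C - x ^+ 2) -> exists2 M, 0 <= M &
    forall i, (i <= N)%N -> forall x, `|derive1n i (poly_exp p q) x| <= M.
Proof.
move=> qC.
apply: (@uniform_bound (fun i M => forall x, `|derive1n i (poly_exp p q) x| <= M)).
  by move=> i M M' MM HM x; exact: le_trans (HM x) MM.
by move=> i; have [r ->] := derive1n_poly_exp p q i; exact: poly_exp_bounded qC.
Qed.

Definition real_schwartz f := smooth f /\
  forall k n, exists M, forall x, `|x| ^+ k * `|derive1n n f x| <= M.

Lemma real_schwartz_weight f K N : real_schwartz f -> exists2 M, 0 <= M &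
  forall n, (n <= N)%N -> forall x, (1 + `|x|) ^+ K * `|derive1n n f x| <= M.
Proof.
move=> [sf fM].
apply: (@uniform_bound (fun n M =>
  forall x, (1 + `|x|) ^+ K * `|derive1n n f x| <= M)).
  by move=> i M M' MM HM x; exact: le_trans (HM x) MM.
move=> n; have [M0 H0] := fM 0%N n; have [M1 H1] := fM K n.
exists (2 ^+ K * (M0 + M1)) => x.
apply: le_trans (ler_wpM2r (normr_ge0 _) (exprD1_le K (normr_ge0 x))) _.
rewrite -mulrA ler_wpM2l ?exprn_ge0// mulrDl lerD//.
by have := H0 x; rewrite expr0.
Qed.

Lemma smooth_cst (c : R) : smooth (fun=> c).
Proof.
rewrite (_ : (fun _ => _) = horner c%:P); first exact: smooth_horner.
by apply/funext => x; rewrite hornerC.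
Qed.

Lemma derive1n_cst (c : R) n : derive1n n.+1 (fun=> c) = fun=> 0 : R.
Proof.
elim: n => [|n IH]; first by apply/funext => x; rewrite derive1nS derive1_cst.
by rewrite derive1nS IH; apply/funext => x; rewrite derive1_cst.
Qed.

(** The derivatives of [1 - G (s * x)] up to order [N] are bounded by [s * C * (1 + |x|)]: the mean
    value theorem gives order 0, the chain rule the others. Leibniz' rule and the decay of [f] leave
    a constant times [s]. *)
Lemma real_schwartz_truncation f N (e : R) : real_schwartz f -> 0 < e ->
  exists2 s : R, 0 < s & forall n, (n <= N)%N -> forall x,
    (1 + `|x|) ^+ N *
    `|derive1n n (fun y => f y * (1 - poly_exp 1 (- 'X^4) (s * y))) x| <= e.
Proof.
move=> Sf e0; have sf := Sf.1; set G := poly_exp 1 (- 'X^4).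
(* The power beyond [N] pays for the factor [1 + |x|] in the bound on [1 - G (s * x)]. *)
have [M M0 fM] := real_schwartz_weight N.+1 N Sf.
have GC : forall x : R, (- 'X^4 : {poly R}).[x] <= 4^-1 - x ^+ 2.
  move=> x; rewrite hornerN hornerXn -subr_ge0.
  have -> : 4^-1 - x ^+ 2 - - x ^+ 4 = (x ^+ 2 - 2^-1) ^+ 2 by field.
  exact: sqr_ge0.
(* Order [N.+1] ensures that the first derivative, used by the mean value theorem, is covered when
   [N = 0]. *)
have [C C0 HC] := derive1n_poly_exp_bounded 1 N.+1 GC.
have sG : smooth G by exact: smooth_poly_exp.
pose D := 2 ^+ N * (C * M).
have D0 : 0 <= D by rewrite !mulr_ge0// exprn_ge0.
(* [s <= 1] gives [s ^+ i.+1 <= s], the other bound gives [s * D <= e]; the [+ 1] allows [D = 0]. *)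
pose s := Num.min 1 (e / (D + 1)).
have D1 : 0 < D + 1 by rewrite ltr_wpDl.
have s0 : 0 < s by rewrite lt_min ltr01 divr_gt0.
have s1 : s <= 1 by rewrite ge_min lexx.
have sD : s * D <= e.
  have : s <= e / (D + 1) by rewrite ge_min lexx orbT.
  rewrite ler_pdivlMr//; apply: le_trans.
  by rewrite ler_wpM2l ?(ltW s0)// lerDl.
exists s => // n nN x.
have x1 : 0 < 1 + `|x| by rewrite ltr_pwDl.
have sGs := smooth_scale (s := s) sG.
have sc := smooth_cst (c := 1 : R).
have mB i : (i <= n)%N ->
    `|derive1n i (fun y => 1 - G (s * y)) x| <= s * C * (1 + `|x|).
  case: i => [_|i iN].
    rewrite derive1n0.
    have G0 : G 0 = 1 by rewrite /G /poly_exp hornerC mul1r hornerN hornerXn expr0n oppr0 expR0.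
    rewrite -{1}G0; have [t _ ->] := smooth_MVT 0 (s * x) sG.
    rewrite sub0r normrM normrN normrM (gtr0_norm s0) mulrCA -mulrA.
    rewrite ler_wpM2l ?(ltW s0)//; apply: ler_pM => //; last by rewrite lerDr.
    exact: (HC 1%N).
  rewrite (derive1nB i.+1 sc sGs) derive1n_cst sub0r normrN.
  rewrite (derive1n_scale s i.+1 sG) normrM normrX (gtr0_norm s0) -mulrA.
  apply: ler_pM; rewrite ?exprn_ge0 ?(ltW s0)//.
    by rewrite exprS ler_piMr ?(ltW s0)// exprn_ile1// ltW.
  apply: (@le_trans _ _ C); first by apply: HC; rewrite (leq_trans iN)// leqW.
  by rewrite ler_peMr// lerDl.
have fB i : (i <= n)%N -> `|derive1n i f x| <= M / (1 + `|x|) ^+ N.+1.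
  move=> ni; rewrite ler_pdivlMr ?exprn_gt0// mulrC.
  by apply: fM; exact: leq_trans ni nN.
have sm := smoothB sc sGs.
have := derive1nM_le sf sm _ _ fB mB.
rewrite divr_ge0 ?exprn_ge0 ?(ltW x1)// !mulr_ge0 ?(ltW s0) ?(ltW x1)//.
move=> /(_ isT isT) H.
apply: le_trans (ler_wpM2l (exprn_ge0 N (ltW x1)) H) _.
apply: le_trans sD.
have -> : (1 + `|x|) ^+ N *
    (2 ^+ n * (M / (1 + `|x|) ^+ N.+1 * (s * C * (1 + `|x|)))) = s * (2 ^+ n * (C * M)).
  rewrite exprSr; field; rewrite gt_eqF// ?exprn_gt0//.
  by rewrite gt_eqF.
rewrite ler_wpM2l ?(ltW s0)// ler_wpM2r ?mulr_ge0//.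
by rewrite ler_eXn2l// ltr1n.
Qed.

(** At [i = 0] the division by [0%:R] returns 0, so the constant term vanishes. *)
Definition poly_primitive p : {poly R} :=
  \poly_(i < (size p).+1) (p`_i.-1 / i%:R).

Lemma poly_primitiveK p : deriv (poly_primitive p) = p.
Proof.
apply/polyP => i; rewrite coef_deriv coef_poly ltnS /=; case: ltnP => ip.
  by rewrite -[_ *+ _]mulr_natr divfK// pnatr_eq0.
by rewrite mul0rn nth_default.
Qed.

Lemma poly_primitive0 p : (poly_primitive p).[0] = 0.
Proof. by rewrite horner_coef0 coef_poly invr0 mulr0. Qed.

(** Each integration chooses the constant so that [h - P] vanishes at 0. The mean value theorem then
    bounds it at [x] by [|x|] times the error of the derivative at some [|t| <= |x|], where the
    weight is no larger; this costs one factor [1 + |x|]. *)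
Lemma poly_approx_primitive N h q (e b : R) : smooth h -> 0 <= e -> 0 <= b ->
  (forall x, `|derive1n N h x - q.[x]| <= e * expR (b * x ^+ 2)) ->
  exists p, forall n, (n <= N)%N -> forall x,
    `|derive1n n (fun y => h y - p.[y]) x| <= e * (1 + `|x|) ^+ N * expR (b * x ^+ 2).
Proof.
move=> + e0 b0; elim: N h => [|N IH] h sh hq.
  by exists q => n; rewrite leqn0 => /eqP-> x; rewrite expr0 mulr1; exact: hq.
have sh' := smooth_derive1 sh.
have [|p Hp] := IH _ sh'; first by move=> x; rewrite -derive1Sn; exact: hq.
pose P := poly_primitive p + (h 0)%:P; exists P.
have sP := @smooth_horner R P.
have hP' : derive1 (fun y => h y - P.[y]) = fun y => derive1 h y - p.[y].
  have := derive1nB 1 sh sP; rewrite !derive1n1 => ->; apply/funext => x.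
  by rewrite -derivE /P derivD derivC addr0 poly_primitiveK.
have x1 (x : R) : 1 <= 1 + `|x| by rewrite lerDl.
case=> [_ x|n nN x]; last first.
  rewrite derive1Sn hP'; apply: le_trans (Hp n nN x) _.
  by rewrite ler_wpM2r ?expR_ge0// ler_wpM2l// exprS ler_peMl// exprn_ge0// addr_ge0.
have [t] := smooth_MVT x 0 (smoothB sh sP).
rewrite hP' normr0 derive1n0 (_ : h 0 - P.[0] = 0); last first.
  by rewrite /P hornerD hornerC poly_primitive0 add0r subrr.
rewrite !subr0 (max_idPl (normr_ge0 x)) => tx ->.
rewrite normrM.
have Ht := Hp 0%N (leq0n N) t; rewrite derive1n0 in Ht.
apply: (@le_trans _ _ (e * (1 + `|x|) ^+ N * expR (b * x ^+ 2) * (1 + `|x|))).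
  apply: ler_pM => //; last by rewrite lerDr.
  apply: le_trans Ht _; apply: ler_pM; rewrite ?expR_ge0 ?mulr_ge0 ?exprn_ge0 ?addr_ge0//.
    by rewrite ler_wpM2l// lerXn2r// ?nnegrE ?addr_ge0// lerD2l.
  rewrite ler_expR ler_wpM2l// -(real_normK (num_real t)) -(real_normK (num_real x)).
  by rewrite lerXn2r// ?nnegrE.
by rewrite mulrAC -[_ * (1 + `|x|)]mulrA -exprSr.
Qed.

(* [f - p w = f (1 - G) + (f G / w - p) w], where [w] is the Gaussian and [G] a
   dilated copy of [expR (- x ^+ 4)]: the first term is small by truncation, and
   [f G / w] is still a Schwartz function. The parity assumption makes its
   derivative of order [K] even. *)
Lemma gaussian_total_parity (a : R) f (q N : nat) (e : R) : 0 < a -> real_schwartz f ->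
  (forall x, f (- x) = (-1) ^+ q * f x) -> 0 < e ->
  exists p, forall n, (n <= N)%N -> forall x, (1 + `|x|) ^+ N *
    `|derive1n n (fun y => f y - p.[y] * expR (- a * y ^+ 2)) x| <= e.
Proof.
move=> a0 Sf fq e0; have sf := Sf.1; have e20 : 0 < e / 2 by rewrite divr_gt0.
(* At least [N], and of the parity of [q], so that [(-1) ^+ K = (-1) ^+ q]. *)
pose K := (N + N + q)%N.
have NK : (N <= K)%N by rewrite /K -addnA leq_addr.
have [s s0 Hs] := real_schwartz_truncation K Sf e20.
(* The exponent of [G (s * x) / w x]; the quartic term dominates, which the square completed in [uC]
   makes explicit. *)
pose u : {poly R} := a *: 'X^2 - s ^+ 4 *: 'X^4.
have uE x : u.[x] = a * x ^+ 2 - s ^+ 4 * x ^+ 4.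
  by rewrite /u !(hornerE, hornerXn).
have uC x : u.[x] <= ((a + 1) / (2 * s ^+ 2)) ^+ 2 - x ^+ 2.
  rewrite uE -subr_ge0.
  have -> : ((a + 1) / (2 * s ^+ 2)) ^+ 2 - x ^+ 2 - (a * x ^+ 2 - s ^+ 4 * x ^+ 4)
    = (s ^+ 2 * x ^+ 2 - (a + 1) / (2 * s ^+ 2)) ^+ 2.
    by field; rewrite gt_eqF.
  exact: sqr_ge0.
pose h x := f x * poly_exp 1 u x.
have su := @smooth_poly_exp R 1 u.
have sh : smooth h by exact (smoothM sf su).
(* Approximation of the [K]-th derivative of [h] uses half of the Gaussian; the other half absorbs
   polynomial factors. *)
pose b := a / 2; have b0 : 0 < b by rewrite divr_gt0.
have [C1 C10 HC1] := derive1n_poly_exp_bounded 1 K uC.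
have [M M0 fM] := real_schwartz_weight 1 K Sf.
have hbound x : `|x| * `|derive1n K h x| <= 2 ^+ K * (C1 * M).
  have x1 : 0 < 1 + `|x| by rewrite ltr_pwDl.
  have fB i : (i <= K)%N -> `|derive1n i f x| <= M / (1 + `|x|).
    by move=> iK; rewrite ler_pdivlMr// mulrC -[X in X * _]expr1; exact: fM.
  have H : `|derive1n K h x| <= 2 ^+ K * (M / (1 + `|x|) * C1).
    apply: derive1nM_le => //; first by rewrite divr_ge0// ltW.
    by move=> i iK; exact: HC1.
  apply: le_trans (ler_pM _ _ (_ : `|x| <= 1 + `|x|) H) _ => //; first by rewrite lerDr.
  by rewrite le_eqVlt; apply/orP; left; apply/eqP; field; rewrite gt_eqF.
have heven x : derive1n K h (- x) = derive1n K h x.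
  have hN : (fun y => h (-1 * y)) = (fun y => (-1) ^+ q * h y).
    apply/funext => y; rewrite /h /poly_exp !hornerC !mul1r.
    have -> : u.[-1 * y] = u.[y] by rewrite !uE; ring.
    by rewrite mulN1r fq mulrA.
  have := derive1n_scale (-1) K sh; rewrite hN (smoothZ_derive _ _ sh).
  move=> /(congr1 (fun k => (-1) ^+ q * k x)).
  have -> : (-1) ^+ K = (-1) ^+ q :> R by rewrite !exprD -expr2 sqrr_sign mul1r.
  by rewrite !signrMK mulN1r => ->.
have ch : continuous (derive1n K h) by exact: smooth_continuous.
have hw := gauss_approx_even b0 ch heven hbound.
pose w := poly_exp 1 (- a *: 'X^2).
have wE x : w x = expR (- a * x ^+ 2).
  by rewrite /w /poly_exp hornerC mul1r hornerZ hornerXn.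
have sw : smooth w by exact: smooth_poly_exp.
(* [K] powers serve the seminorm weight and [K] more the [K] integrations. *)
have [C C0 wC] : exists2 C, 0 <= C & forall i, (i <= K)%N -> forall x,
    (1 + `|x|) ^+ (K + K) * `|derive1n i w x| <= C * expR (- b * x ^+ 2).
  apply: (@uniform_bound (fun i C => forall x,
    (1 + `|x|) ^+ (K + K) * `|derive1n i w x| <= C * expR (- b * x ^+ 2))).
    move=> i C C' CC HC x; apply: le_trans (HC x) _.
    by rewrite ler_wpM2r// expR_ge0.
  move=> i; have [r rE] := derive1n_poly_exp 1 (- a *: 'X^2) i.
  (* The exponent [K + K] is even, so the polynomial [1 + 'X^(K + K)] takes the value
     [1 + |x| ^+ (K + K)]. *)
  have [C HC] := poly_gauss_bounded (r * (1 + 'X^(K + K))) b0.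
  exists (2 ^+ (K + K) * C) => x; rewrite /w rE /poly_exp hornerZ hornerXn.
  apply: le_trans (ler_wpM2r (normr_ge0 _) (exprD1_le (K + K) (normr_ge0 x))) _.
  rewrite -!mulrA ler_wpM2l ?exprn_ge0//.
  have -> : - a * x ^+ 2 = - b * x ^+ 2 + - b * x ^+ 2 by rewrite /b; field.
  have := HC x; rewrite expRD; set E := expR _ => rC.
  have E0 : 0 <= E by exact: expR_ge0.
  rewrite !normrM (ger0_norm E0) !mulrA ler_wpM2r//; apply: le_trans rC.
  rewrite normrM (ger0_norm E0) ler_wpM2r// hornerM normrM mulrC ler_wpM2l//.
  rewrite hornerD hornerXn hornerC ger0_norm -?normrX ?lerD2l ?ler_norm//.
    by rewrite ger0_norm// exprD -expr2 sqr_ge0.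
  by rewrite addr_ge0// exprD -expr2 sqr_ge0.
have [eta eta0 etaE] : exists2 eta, 0 < eta & eta * (2 ^+ K * C + 1) = e / 2.
  have D1 : 0 < 2 ^+ K * C + 1 by rewrite ltr_wpDl// mulr_ge0// exprn_ge0.
  by exists (e / 2 / (2 ^+ K * C + 1)); [rewrite divr_gt0|rewrite divfK// gt_eqF].
have [Q HQ] := hw _ eta0.
have HQ' x : `|derive1n K h x - Q.[x]| <= eta * expR (b * x ^+ 2).
  by have := HQ x; rewrite mulNr expRN ler_pdivrMr// expR_gt0.
have [P HP] := poly_approx_primitive sh (ltW eta0) (ltW b0) HQ'.
exists P => n nN x.
have nK := leq_trans nN NK.
have x1 : 1 <= 1 + `|x| by rewrite lerDl.
have x0 : 0 < 1 + `|x| by rewrite ltr_pwDl.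
have sP := @smooth_horner R P.
have shP := smoothB sh sP.
have sG1 : smooth (fun y => 1 - poly_exp 1 (- 'X^4) (s * y)).
  exact (smoothB (smooth_cst (c := 1))
    (smooth_scale (s := s) (smooth_poly_exp (p := 1) (q := - 'X^4)))).
have -> : (fun y => f y - P.[y] * expR (- a * y ^+ 2)) =
    (fun y => f y * (1 - poly_exp 1 (- 'X^4) (s * y)) + (h y - P.[y]) * w y).
  apply/funext => y; rewrite mulrBl /h -mulrA.
  have -> : poly_exp 1 u y * w y = poly_exp 1 (- 'X^4) (s * y).
    rewrite wE /poly_exp !hornerC !mul1r -expRD uE hornerN hornerXn exprMn.
    by congr expR; ring.
  by rewrite wE; ring.
rewrite (smoothD_derive n (smoothM sf sG1) (smoothM shP sw)).
apply: (@le_trans _ _ ((1 + `|x|) ^+ K *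
  (`|derive1n n (fun y => f y * (1 - poly_exp 1 (- 'X^4) (s * y))) x| +
   `|derive1n n (fun y => (h y - P.[y]) * w y) x|))).
  apply: ler_pM; rewrite ?exprn_ge0 ?(ltW x0)//; last exact: ler_normD.
  exact: ler_weXn2l.
rewrite mulrDr [e]splitr; apply: lerD; first exact: Hs.
have wB i : (i <= n)%N ->
    `|derive1n i w x| <= C * expR (- b * x ^+ 2) / (1 + `|x|) ^+ (K + K).
  move=> iN; rewrite ler_pdivlMr ?exprn_gt0// mulrC.
  by apply: wC; exact: leq_trans iN nK.
have hB i : (i <= n)%N -> `|derive1n i (fun y => h y - P.[y]) x| <=
    eta * (1 + `|x|) ^+ K * expR (b * x ^+ 2).
  by move=> iN; apply: HP; exact: leq_trans iN nK.
have := derive1nM_le shP sw _ _ hB wB.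
rewrite !mulr_ge0 ?invr_ge0 ?exprn_ge0 ?expR_ge0 ?(ltW x0) ?(ltW eta0)//.
move=> /(_ isT isT) H.
apply: le_trans (ler_wpM2l (exprn_ge0 K (ltW x0)) H) _.
rewrite mulNr expRN.
(* The exponentials and the powers of [1 + |x|] cancel exactly, leaving a bound free of [x]. *)
have -> : (1 + `|x|) ^+ K * (2 ^+ n * (eta * (1 + `|x|) ^+ K * expR (b * x ^+ 2) *
   (C / expR (b * x ^+ 2) / (1 + `|x|) ^+ (K + K)))) = eta * (2 ^+ n * C).
  by rewrite exprD; field; rewrite !gt_eqF ?expR_gt0 ?exprn_gt0.
apply: (@le_trans _ _ (eta * (2 ^+ K * C + 1))).
  rewrite ler_wpM2l ?(ltW eta0)//; apply: (@le_trans _ _ (2 ^+ K * C)).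
    by rewrite ler_wpM2r// ler_eXn2l// ltr1n.
  by rewrite lerDl.
by rewrite etaE.
Qed.

(** [f] is the sum of its even part ([q = 0]) and odd part ([q = 1]), each approximated within
    [e / 2]. *)
Lemma gaussian_total_real (a : R) f N (e : R) : 0 < a -> real_schwartz f -> 0 < e ->
  exists p, forall n, (n <= N)%N -> forall x, (1 + `|x|) ^+ N *
    `|derive1n n (fun y => f y - p.[y] * expR (- a * y ^+ 2)) x| <= e.
Proof.
move=> a0 [sf fM] e0; have e20 : 0 < e / 2 by rewrite divr_gt0.
have part (q : nat) : real_schwartz (fun x => 2^-1 * f x + 2^-1 * (-1) ^+ q * f (-1 * x)).
  have sN := smooth_scale (s := -1) sf.
  have s1 := smoothZ (a := 2^-1) sf; have s2 := smoothZ (a := 2^-1 * (-1) ^+ q) sN.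
  split=> [|k n]; first exact (smoothD s1 s2).
  have [M HM] := fM k n; exists M => x.
  rewrite (smoothD_derive n s1 s2) (smoothZ_derive _ n sf) (smoothZ_derive _ n sN).
  rewrite (derive1n_scale (-1) n sf).
  have h2 : `|2^-1 : R| = 2^-1 by rewrite ger0_norm.
  apply: le_trans (ler_wpM2l (exprn_ge0 k (normr_ge0 x)) (ler_normD _ _)) _.
  rewrite !normrM !normrX normrN normr1 !expr1n mulr1 mul1r h2 mulrDr.
  rewrite ![`|x| ^+ k * (_ * _)]mulrCA.
  have := HM (-1 * x); rewrite normrM normrN normr1 mul1r => H2.
  have H1 := HM x.
  by apply: le_trans (lerD (ler_wpM2l _ H1) (ler_wpM2l _ H2)) _ => //; lra.
have parity (q : nat) x : 2^-1 * f (- x) + 2^-1 * (-1) ^+ q * f (-1 * - x) =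
    (-1) ^+ q * (2^-1 * f x + 2^-1 * (-1) ^+ q * f (-1 * x)).
  rewrite !mulN1r opprK mulrDr [RHS]addrC !mulrA.
  by rewrite [_ * 2^-1 * (-1) ^+ q]mulrAC -signr_odd -expr2 sqrr_sign mul1r [_ * 2^-1]mulrC.
have [p0 H0] := gaussian_total_parity N a0 (part 0%N) (parity 0%N) e20.
have [p1 H1] := gaussian_total_parity N a0 (part 1%N) (parity 1%N) e20.
have sg p : smooth (fun y => p.[y] * expR (- a * y ^+ 2)).
  rewrite (_ : (fun _ => _) = poly_exp p (- a *: 'X^2)); first exact: smooth_poly_exp.
  by apply/funext => y; rewrite /poly_exp hornerZ hornerXn.
exists (p0 + p1) => n nN x.
have s0 := smoothB (part 0%N).1 (sg p0); have s1 := smoothB (part 1%N).1 (sg p1).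
have -> : (fun y => f y - (p0 + p1).[y] * expR (- a * y ^+ 2)) = (fun y =>
   (2^-1 * f y + 2^-1 * (-1) ^+ 0 * f (-1 * y) - p0.[y] * expR (- a * y ^+ 2)) +
   (2^-1 * f y + 2^-1 * (-1) ^+ 1 * f (-1 * y) - p1.[y] * expR (- a * y ^+ 2))).
  by apply/funext => y; rewrite hornerD expr0 expr1; field.
rewrite (smoothD_derive n s0 s1).
apply: le_trans (ler_wpM2l (exprn_ge0 N _) (ler_normD _ _)) _.
  by rewrite addr_ge0.
by rewrite mulrDr [e]splitr; apply: lerD; [exact: H0|exact: H1].
Qed.

End real_approximation.

(** * Density and determinacy *)

Section gaussian_density.
Variable R : realType.
Implicit Types f g : schwartz R.

Lemma normc_le_ReIm (z : R[i]) : Normc.normc z <= `|complex.Re z| + `|complex.Im z|.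
Proof.
case: z => u v /=; rewrite -[leRHS]ger0_norm ?addr_ge0// -sqrtr_sqr ler_wsqrtr//.
rewrite -(real_normK (num_real u)) -(real_normK (num_real v)) sqrrD lerD2r.
by rewrite lerDl mulrn_wge0// mulr_ge0.
Qed.

Lemma ReIm_le_normc (z : R[i]) :
  `|complex.Re z| <= Normc.normc z /\ `|complex.Im z| <= Normc.normc z.
Proof.
case: z => u v /=; rewrite -!sqrtr_sqr; split; rewrite ler_wsqrtr//.
  by rewrite lerDl sqr_ge0.
by rewrite lerDr sqr_ge0.
Qed.

Lemma real_schwartz_ReIm f :
  real_schwartz (@complex.Re R \o f) /\ real_schwartz (@complex.Im R \o f).
Proof.
have [sRe sIm] := schwartz_smooth f.
split; split=> // k n; exists (schwartz_seminorm k n f) => x;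
  apply: le_trans (seminorm_ub k n f x); rewrite ler_wpM2l ?exprn_ge0//.
  exact: (ReIm_le_normc (cderiv1n n f x)).1.
exact: (ReIm_le_normc (cderiv1n n f x)).2.
Qed.

Lemma schwartz_sum_fun (I : Type) (s : seq I) (u : I -> schwartz R) (x : R) :
  (\sum_(i <- s) u i : schwartz R) x = \sum_(i <- s) u i x.
Proof. by elim/big_rec2: _ => // i y z _ <-. Qed.

(** The complex coefficients pair those of [p] and [q], padded to a common length and divided by [c]
    to cancel the amplitude of the Gaussian. *)
Lemma lin_span_gaussian (c a : R) (a0 : 0 < a) (p q : {poly R}) : 0 < c ->
  exists2 g : schwartz R, lin_span (fun n => mulXn n (gaussian c a0)) g &
    forall x, g x = (p.[x] * expR (- a * x ^+ 2)) +i* (q.[x] * expR (- a * x ^+ 2)).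
Proof.
move=> c0; pose m := maxn (size p) (size q).
pose s := [seq ((p`_i / c) +i* (q`_i / c), i) | i <- index_iota 0 m].
exists (\sum_(r <- s) r.1 *: mulXn r.2 (gaussian c a0)); first by exists s.
move=> x; rewrite schwartz_sum_fun big_map big_mkord.
rewrite (horner_coef_wide x (leq_maxl _ _ : size p <= m)%N).
rewrite (horner_coef_wide x (leq_maxr _ _ : size q <= m)%N).
elim: (m) => [|k IH]; first by rewrite !big_ord0 !mul0r.
rewrite !big_ord_recr /= IH !mulrDl.
set A := _ * expR _; set B := _ * expR _; set E := expR _.
rewrite [in LHS]/GRing.add/= -/E; congr (_ +i* _); congr (_ + _);
  by field; rewrite gt_eqF.
Qed.

(** Real and imaginary parts are approximated separately; the weight [(1 + |x|) ^+ N] dominates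
    every [|x| ^+ k] with [k <= N], so one estimate serves all seminorms of the ball. *)
Lemma gaussian_approx (c a : R) (a0 : 0 < a) f N (e : R) : 0 < c -> 0 < e ->
  exists2 g : schwartz R, lin_span (fun n => mulXn n (gaussian c a0)) g &
    schwartz_ball f N e g.
Proof.
move=> c0 e0; have [SR SI] := real_schwartz_ReIm f.
have e40 : 0 < e / 4 by rewrite divr_gt0.
have [p Hp] := gaussian_total_real N a0 SR e40.
have [q Hq] := gaussian_total_real N a0 SI e40.
have [g gs gE] := lin_span_gaussian a0 p q c0.
(* A supremum inherits only a weak inequality, hence the total [e / 2], strictly below [e]. *)
exists g => // k n kN nN; apply: (@le_lt_trans _ _ (e / 4 + e / 4)); last by lra.
have [sgR sgI] := schwartz_smooth g.
apply: seminorm_le => x.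
have ReE : @complex.Re R \o schwartz_fun (g - f) =
    fun y => (@complex.Re R \o g) y - (@complex.Re R \o f) y.
  apply/funext => y; transitivity (complex.Re (g y - f y)) => //=.
  by case: (g y) (f y) => ? ? [].
have ImE : @complex.Im R \o schwartz_fun (g - f) =
    fun y => (@complex.Im R \o g) y - (@complex.Im R \o f) y.
  apply/funext => y; transitivity (complex.Im (g y - f y)) => //=.
  by case: (g y) (f y) => ? ? [].
have {}Hp : (1 + `|x|) ^+ N * `|derive1n n (fun y =>
    (@complex.Re R \o f) y - (@complex.Re R \o g) y) x| <= e / 4.
  rewrite (_ : @complex.Re R \o g = fun y => p.[y] * expR (- a * y ^+ 2)).
    exact: Hp.
  by apply/funext => y /=; rewrite gE.
have {}Hq : (1 + `|x|) ^+ N * `|derive1n n (fun y =>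
    (@complex.Im R \o f) y - (@complex.Im R \o g) y) x| <= e / 4.
  rewrite (_ : @complex.Im R \o g = fun y => q.[y] * expR (- a * y ^+ 2)).
    exact: Hq.
  by apply/funext => y /=; rewrite gE.
have x1 : 1 <= 1 + `|x| by rewrite lerDl.
have xk (t : R) : 0 <= t -> `|x| ^+ k * t <= (1 + `|x|) ^+ N * t.
  move=> t0; rewrite ler_wpM2r//; apply: (@le_trans _ _ ((1 + `|x|) ^+ k)).
    by rewrite lerXn2r ?nnegrE ?addr_ge0// lerDr.
  exact: ler_weXn2l.
apply: le_trans (ler_wpM2l (exprn_ge0 k (normr_ge0 x)) (normc_le_ReIm _)) _.
rewrite /cderiv1n /= ReE ImE mulrDr; apply: lerD.
  apply: le_trans (xk _ (normr_ge0 _)) _.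
  move: Hp; rewrite (derive1nB n SR.1 sgR) (derive1nB n sgR SR.1).
  by rewrite distrC.
apply: le_trans (xk _ (normr_ge0 _)) _.
move: Hq; rewrite (derive1nB n SI.1 sgI) (derive1nB n sgI SI.1).
by rewrite distrC.
Qed.

Lemma scalar_lin_span (I : Type) (u : I -> schwartz R) (T1 T2 : schwartz R -> R[i]) :
  scalar T1 -> scalar T2 -> (forall i, T1 (u i) = T2 (u i)) ->
  forall v, lin_span u v -> T1 v = T2 v.
Proof.
have T0 (T : schwartz R -> R[i]) : scalar T -> T 0 = 0.
  by move=> sT; have := sT (-1) 0 0; rewrite scaler0 addr0 mulN1r addNr.
move=> s1 s2 uE _ [s ->]; elim: s => [|r s IH]; first by rewrite big_nil !T0.
by rewrite big_cons s1 s2 uE IH.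
Qed.

(** The set where [T1] and [T2] differ is open, as the preimage of the complement of the closed
    point 0; if nonempty it would meet [S]. *)
Lemma continuous_eq_dense (S : set (schwartz R)) (T1 T2 : schwartz R -> R[i]^o) :
  continuous T1 -> continuous T2 -> dense S -> (forall v, S v -> T1 v = T2 v) ->
  T1 = T2.
Proof.
move=> c1 c2 dS E; apply/funext => f; apply/eqP/negPn/negP => neq.
pose O : set (schwartz R) := (fun v => T1 v - T2 v) @^-1` ~` [set 0].
have oO : open O.
  apply: open_comp => [v _|]; first exact: cvgB (c1 v) (c2 v).
  by apply: closed_openC; apply: accessible_closed_set1;
    apply: hausdorff_accessible; exact: norm_hausdorff.
have [|v [Ov Sv]] := dS O _ oO.
  by exists f => /= /eqP; rewrite subr_eq0; exact/negP.
by apply: Ov => /=; rewrite (E v Sv) subrr.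
Qed.

End gaussian_density.

Theorem theorem6p2 (R : realType) (c a : R) (c0 : 0 < c) (a0 : 0 < a) :
  total_family (fun n => mulXn n (gaussian c a0)) /\
  (forall T1 T2 : schwartz R -> R[i]^o,
     tempered_distribution T1 -> tempered_distribution T2 ->
     (forall n, weak_moment (gaussian c a0) T1 n = weak_moment (gaussian c a0) T2 n) ->
     T1 = T2).
Proof.
have total : total_family (fun n => mulXn n (gaussian c a0)).
  move=> O [f Of] oO.
  have [N [e [e0 fO]]] : nbhs f O by exact: open_nbhs_nbhs.
  have [g gs gf] := gaussian_approx a0 f N c0 e0.
  by exists g; split=> //; exact: fO.
split=> // T1 T2 [s1 c1] [s2 c2] E.
by apply: (continuous_eq_dense c1 c2 total); exact: scalar_lin_span s1 s2 E.
Qed.
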